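(* Let $E$ and $F$ be Banach lattices and let ${\mathcal P}$ be a linear subspace of $\mathrm{L}(E,F)$ that is closed in the operator norm. Then the space $\mathrm{r}\text{-}{\mathcal P}(E,F)$ of regularly ${\mathcal P}$-operators is a Banach space under the enveloping norm $\|\cdot\|_{\mathrm{r}\text{-}{\mathcal P}}$.
   Context: All vector spaces are real and all operators are linear. $\mathrm{L}(E,F)$ is the space of all continuous linear operators from $E$ to $F$, with operator norm $\|\cdot\|$. It is ordered by $S\le T$ iff $Sx\le Tx$ for all $x\in E_+$, where $E_+$ is the positive cone of $E$; $\mathrm{L}_+(E,F)$ denotes the set of positive operators in $\mathrm{L}(E,F)$, i.e. those $T$ with $0\le T$. For ${\mathcal P}\subseteq \mathrm{L}(E,F)$, an operator $T:E\to F$ is a regularly ${\mathcal P}$-operator if $T=T_1-T_2$ for some $T_1,T_2\in{\mathcal P}\cap \mathrm{L}_+(E,F)$; the set of all such operators is denoted $\mathrm{r}\text{-}{\mathcal P}(E,F)$. For a linear subspace ${\mathcal P}$ of $\mathrm{L}(E,F)$, the enveloping norm on $\mathrm{r}\text{-}{\mathcal P}(E,F)$ is $\|T\|_{\mathrm{r}\text{-}{\mathcal P}}:=\inf\{\|S\| : S\in{\mathcal P},\ T\le S \text{ and } -T\le S\}$. *)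

(* Defs.v *)
From HB Require Import structures.
From mathcomp Require Import all_boot all_order all_algebra.
From mathcomp Require Import boolp classical_sets functions reals.
From mathcomp Require Import topology normedtype.

Set Implicit Arguments.
Unset Strict Implicit.
Unset Printing Implicit Defensive.

Import Order.TTheory GRing.Theory Num.Theory.
Import numFieldNormedType.Exports.

Local Open Scope classical_set_scope.
Local Open Scope ring_scope.

(* The order is carried by the mixin rather than inherited from [Order.Lattice]:
   Hierarchy Builder rejects a join of an order and a normed module declared
   after [Num.NumDomain].  In the last axiom [vjoin x (- x)] is the lattice
   modulus of [x], while [`|x|] is its norm. *)
HB.mixin Record CompleteNormedModule_isBanachLattice (R : realType) E
    & CompleteNormedModule R E := {
  vle : rel E ;
  vle_refl : reflexive vle ;
  vle_anti : antisymmetric vle ;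
  vle_trans : transitive vle ;
  vjoin : E -> E -> E ;
  vmeet : E -> E -> E ;
  vjoin_le : forall x y z : E, vle (vjoin x y) z = vle x z && vle y z ;
  le_vmeet : forall x y z : E, vle z (vmeet x y) = vle z x && vle z y ;
  vle_wD2r : forall z x y : E, vle x y -> vle (x + z) (y + z) ;
  vscale_ge0 : forall (a : R) (x : E), 0 <= a -> vle 0 x -> vle 0 (a *: x) ;
  vle_norm : forall x y : E,
    vle (vjoin x (- x)) (vjoin y (- y)) -> `|x| <= `|y|
}.

#[short(type="banachLatticeType")]
HB.structure Definition BanachLattice (R : realType) :=
  {E of CompleteNormedModule R E & CompleteNormedModule_isBanachLattice R E}.

Section ContinuousLinear.
Variables (R : realType) (E F : normedModType R).

Definition continuous_linear : {pred E -> F} :=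
  fun T => `[< linear T /\ continuous T >].

Lemma continuous_linear_submod_closed : submod_closed continuous_linear.
Proof.
split.
  apply/asboolP; split; last by move=> x; exact: cvg_cst.
  by move=> a x y; rewrite -[RHS]/(a *: (0 : F) + 0) scaler0 addr0.
move=> a S T /asboolP[Sl Sc] /asboolP[Tl Tc]; apply/asboolP; split.
  move=> b x y; rewrite -[LHS]/(a *: S (b *: x + y) + T (b *: x + y)).
  rewrite -[RHS]/(b *: (a *: S x + T x) + (a *: S y + T y)).
  rewrite Sl Tl !scalerDr !scalerA (mulrC a b) -!addrA; congr (_ + _).
  by rewrite addrCA.
by move=> x; apply: (@cvgD _ _ _ _ _ (a \*: S) T);
  [apply: cvgZr; exact: Sc | exact: Tc].
Qed.

HB.instance Definition _ :=
  GRing.isSubmodClosed.Build R (E -> F) continuous_linear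
    continuous_linear_submod_closed.

Record bounded_op := BoundedOp {
  bounded_op_fun :> E -> F ;
  bounded_opP : bounded_op_fun \in continuous_linear
}.

HB.instance Definition _ := [isSub for bounded_op_fun].
HB.instance Definition _ := [Choice of bounded_op by <:].
HB.instance Definition _ := [SubChoice_isSubLmodule of bounded_op by <:].

Lemma bounded_op_linear (T : bounded_op) : linear T.
Proof. by have /asboolP[] := bounded_opP T. Qed.

Lemma bounded_op_continuous (T : bounded_op) : continuous T.
Proof. by have /asboolP[] := bounded_opP T. Qed.

HB.instance Definition _ (T : bounded_op) :=
  GRing.isLinear.Build R E F *:%R (bounded_op_fun T) (bounded_op_linear T).

Definition opnorm (T : bounded_op) : R :=
  sup [set `|T x| | x in [set x : E | `|x| <= 1]].

Let opnorm_has_sup (T : bounded_op) :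
  has_sup [set `|T x| | x in [set x : E | `|x| <= 1]].
Proof.
split; first by exists `|T 0|, 0 => //=; rewrite normr0.
have /bounded_funP/(_ 1)[M TM] : bounded_near T (nbhs (0 : E)).
  by apply: continuous_linear_bounded; exact: bounded_op_continuous.
by exists M => _ [x /= x1 <-]; exact: TM.
Qed.

Let opnorm_ub (T : bounded_op) x : `|x| <= 1 -> `|T x| <= opnorm T.
Proof. by move=> x1; apply: sup_upper_bound => //; exists x. Qed.

Let opnorm_le (T : bounded_op) c :
  (forall x, `|x| <= 1 -> `|T x| <= c) -> opnorm T <= c.
Proof.
move=> Tc; apply: ge_sup; first by case: (opnorm_has_sup T).
by move=> _ [x /= /Tc ? <-].
Qed.

Let opnorm_triangle S T : opnorm (S + T) <= opnorm S + opnorm T.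
Proof.
apply: opnorm_le => x x1; apply: le_trans (ler_normD (S x) (T x)) _.
by apply: lerD; exact: opnorm_ub.
Qed.

Let opnormZ_le a T : opnorm (a *: T) <= `|a| * opnorm T.
Proof.
apply: opnorm_le => x x1; rewrite -[X in `|X|]/(a *: T x) normrZ.
by apply: ler_wpM2l => //; exact: opnorm_ub.
Qed.

Let opnormZ a T : opnorm (a *: T) = `|a| * opnorm T.
Proof.
have [->|a0] := eqVneq a 0.
  apply/eqP; rewrite eq_le opnormZ_le normr0 mul0r /=.
  by apply: le_trans (@opnorm_ub (0 *: T) 0 _); rewrite ?normr0.
apply/eqP; rewrite eq_le opnormZ_le /=.
rewrite -ler_pdivlMl ?normr_gt0// -normfV.
by rewrite -{1}(scalerK a0 T); exact: opnormZ_le.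
Qed.

Let opnorm_eq0 T : opnorm T = 0 -> T = 0.
Proof.
move=> T0; apply: val_inj; apply/funext => x /=.
apply/eqP; change (T x == 0).
have [->|x0] := eqVneq x 0; first by rewrite linear0.
have nx0 : `|x| != 0 by rewrite normr_eq0.
have := @opnorm_ub T (`|x|^-1 *: x); rewrite T0 normrZ normfV normr_id mulVf//.
rewrite linearZ /= normr_le0 scaler_eq0 invr_eq0 (negbTE nx0) /=.
by apply.
Qed.

HB.instance Definition _ :=
  Lmodule_isNormed.Build R bounded_op opnorm_triangle opnormZ opnorm_eq0.

End ContinuousLinear.

Notation "''L' ( E , F )" := (@bounded_op _ E F)
  (at level 8, format "''L' ( E ,  F )") : type_scope.

(* [is_banach A N]: the subset [A] of [V], with the operations of [V] and the
   norm [N], is a Banach space. *)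
Definition is_banach (R : realType) (V : lmodType R) (A : set V) (N : V -> R) :=
  exists (X : completeNormedModType R) (i : {linear X -> V}),
    [/\ injective i, range i = A & forall x : X, N (i x) = `|x|].

Section RegularOperators.
Variables (R : realType) (E F : banachLatticeType R).
Implicit Types (S T : 'L(E, F)) (P : set 'L(E, F)).

Definition op_le S T := forall x : E, vle 0 x -> vle (S x) (T x).

Definition positive_op : set 'L(E, F) := [set T | op_le 0 T].

Definition regularly P : set 'L(E, F) :=
  [set T | exists T1 T2, [/\ (P `&` positive_op) T1, (P `&` positive_op) T2
                           & T = T1 - T2]].

Definition enveloping_norm P T : R :=
  inf [set `|S| | S in [set S | [/\ P S, op_le T S & op_le (- T) S]]].

End RegularOperators.

(* Main.v *)
From HB Require Import structures.
Require Import Defs.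
From mathcomp Require Import all_boot all_order all_algebra.
From mathcomp Require Import boolp classical_sets functions reals.
From mathcomp Require Import topology normedtype sequences.

Set Implicit Arguments.
Unset Strict Implicit.
Unset Printing Implicit Defensive.

Import Order.TTheory GRing.Theory Num.Theory numFieldNormedType.Exports.
Local Open Scope classical_set_scope.
Local Open Scope ring_scope.

(** Write [dominates T S] when [T] and [- T] both lie below [S].  Everything rests
    on two facts about an operator [T] dominated by [S].

    First, [T] is regular with respect to the subspace [P] exactly when [T] lies
    in [P] and is dominated by a member [S] of [P]: given [S], write [T] as the
    difference of the positive operators [(S + T) / 2] and [(S - T) / 2]
    ([regularlyP]).  The regular operators therefore form a subspace, and the
    enveloping norm is the infimum of [`|S|] over the dominating [S] in [P];
    homogeneity and the triangle inequality follow because domination is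
    compatible with sums and scalings.

    Second, [`|T| <= `|S|] ([dominates_opnorm]).  Hence the enveloping norm is at
    least the operator norm, which makes it definite.

    For completeness it suffices to treat sequences [T n] whose increments have
    enveloping norm less than [2^-n] ([geometric_complete]).  Choose [S n] in [P]
    dominating [T n.+1 - T n] with [`|S n| < 2^-n].  Since [F] is complete, so is
    the space of continuous operators ([bounded_op_complete]); the series of the
    [S n] thus converges to some [A], and, by the second fact, [T n] converges to
    some [L], both in operator norm; both limits are in [P], which is closed.
    The positive cone of a Banach lattice is closed ([vle0_closed]), so the
    domination of the increments can be summed: the tail [A - series S n]
    dominates [L - T n] ([dominates_series_tail]).  This shows at once that [L] is
    regular and that the enveloping norm of [L - T n] is at most
    [`|A - series S n|], which tends to 0. *)

#[local] Arguments vle_trans {R s} [y x z].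
#[local] Arguments vle_norm {R s} [x y].

Lemma half_double (R : numFieldType) (V : lmodType R) (x : V) :
  2^-1 *: (x + x) = x.
Proof. by rewrite -mulr2n -[x *+ 2]scaler_nat scalerK// pnatr_eq0. Qed.

Lemma subrACA (V : zmodType) (a b c d : V) : a - b - (c - d) = a - c - (b - d).
Proof. by rewrite !opprD !opprK addrACA. Qed.

(** * Banach lattices *)

Section BanachLattice.
Variables (R : realType) (E : banachLatticeType R).
Implicit Types (x y z : E).

Lemma vle_sub x y : vle x y = vle 0 (y - x).
Proof.
apply/idP/idP => h.
  by have := vle_wD2r (- x) _ _ h; rewrite subrr.
by have := vle_wD2r x _ _ h; rewrite add0r subrK.
Qed.

Lemma vleD x y x' y' : vle x y -> vle x' y' -> vle (x + x') (y + y').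
Proof.
move=> xy xy'; apply: vle_trans (vle_wD2r x' _ _ xy) _.
by rewrite ![y + _]addrC; exact: vle_wD2r.
Qed.

Lemma vleN2 x y : vle x y -> vle (- y) (- x).
Proof. by rewrite vle_sub => xy; rewrite vle_sub opprK addrC. Qed.

Lemma vleZ (a : R) x y : 0 <= a -> vle x y -> vle (a *: x) (a *: y).
Proof.
move=> a0; rewrite vle_sub => xy.
by rewrite vle_sub -scalerBr; exact: vscale_ge0.
Qed.

(** The lattice modulus; [`|x|] is the norm. *)
Definition vabs x := vjoin x (- x).

Lemma vabs_le x z : vle (vabs x) z = vle x z && vle (- x) z.
Proof. exact: vjoin_le. Qed.

Lemma le_vabs x : vle x (vabs x).
Proof. by have := vabs_le x (vabs x); rewrite vle_refl => /esym/andP[]. Qed.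

Lemma leN_vabs x : vle (- x) (vabs x).
Proof. by have := vabs_le x (vabs x); rewrite vle_refl => /esym/andP[]. Qed.

(** Adding the two inequalities gives [0 <= 2 z]. *)
Lemma vle_pm_ge0 x z : vle x z -> vle (- x) z -> vle 0 z.
Proof.
move=> xz nxz; have := vleD xz nxz; rewrite subrr => h.
have := vleZ (a := 2^-1) _ h; rewrite scaler0 half_double.
by apply; rewrite invr_ge0.
Qed.

Lemma vabs_ge0 x : vle 0 (vabs x).
Proof. exact: vle_pm_ge0 (le_vabs x) (leN_vabs x). Qed.

Lemma ge0_vabs x : vle 0 x -> vabs x = x.
Proof.
move=> x0; apply/vle_anti; rewrite le_vabs andbT vabs_le vle_refl /=.
by apply: (vle_trans _ x0); have := vleN2 x0; rewrite oppr0.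
Qed.

(** The norm axiom compares moduli, and taking the modulus is idempotent. *)
Lemma norm_vabs x : `|vabs x| = `|x|.
Proof.
have e : vjoin (vabs x) (- vabs x) = vabs x := ge0_vabs (vabs_ge0 x).
by apply/eqP; rewrite eq_le !vle_norm// e; exact: vle_refl.
Qed.

Lemma vle_pm_norm x z : vle x z -> vle (- x) z -> `|x| <= `|z|.
Proof.
move=> xz nxz; apply: vle_norm.
have -> : vjoin z (- z) = z := ge0_vabs (vle_pm_ge0 xz nxz).
by rewrite vjoin_le xz.
Qed.

(** If [x] is a limit of positive vectors [y], the negative part
    [vjoin (- x) 0] of [x] lies between 0 and the modulus of [y - x], because
    [- x <= y - x].  Its norm is thus at most [`|y - x|], hence it vanishes. *)
Lemma vle0_closed : closed [set x : E | vle 0 x].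
Proof.
move=> x clx; rewrite /= -[x]opprK; have := @vleN2 (- x) 0; rewrite oppr0; apply.
(* [p] is the negative part of [x]; it bounds [- x], so it suffices that [p = 0]. *)
set p := vjoin (- x) 0.
have /andP[xp p0] : vle (- x) p && vle 0 p by rewrite -vjoin_le vle_refl.
suff -> : 0 = p by [].
apply/esym/eqP; rewrite -normr_le0; apply/ler_addgt0Pr => e e0; rewrite add0r.
have [y [y0 xy]] := clx _ (nbhsx_ballx x e e0).
rewrite -ball_normE /= distrC in xy; apply: le_trans (ltW xy).
rewrite -(norm_vabs (y - x)).
have pb : vle p (vabs (y - x)).
  rewrite vjoin_le vabs_ge0 andbT; apply: vle_trans (le_vabs _).
  by rewrite vle_sub opprK subrK.
apply: vle_pm_norm pb _; apply: vle_trans (vabs_ge0 _).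
by have := vleN2 p0; rewrite oppr0.
Qed.

End BanachLattice.

(** * The operator norm *)

Section OperatorNorm.
Variables (R : realType) (E F : normedModType R).
Implicit Types T : 'L(E, F).

Lemma opnorm_le T (c : R) :
  0 <= c -> (forall x, `|T x| <= c * `|x|) -> `|T| <= c.
Proof.
move=> c0 Tc; rewrite -[`|T|]/(opnorm T); apply: ge_sup.
  by exists `|T 0|, 0 => //=; rewrite normr0.
move=> _ [x /= x1 <-]; apply: le_trans (Tc x) _.
by rewrite ler_piMr.
Qed.

Lemma le_opnorm T x : `|T x| <= `|T| * `|x|.
Proof.
have ub y : `|y| <= 1 -> `|T y| <= `|T|.
  move=> y1; rewrite -[`|T|]/(opnorm T); apply: sup_upper_bound; last by exists y.
  split; first by exists `|T 0|, 0 => //=; rewrite normr0.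
  have /bounded_funP/(_ 1)[M TM] : bounded_near T (nbhs (0 : E)).
    by apply: continuous_linear_bounded; exact: bounded_op_continuous.
  by exists M => _ [z /= z1 <-]; exact: TM.
have [->|x0] := eqVneq x 0; first by rewrite linear0 !normr0 mulr0.
have nx0 : 0 < `|x| by rewrite normr_gt0.
rewrite -ler_pdivrMr// mulrC -[X in X * _]ger0_norm ?invr_ge0// -normrZ -linearZ.
by apply: ub; rewrite normrZ normfV normr_id mulVf ?gt_eqF.
Qed.

(** Adding 1 to [`|x|] keeps the radius positive when [x = 0]. *)
Lemma eval_ball x (e : R) S T :
  ball S (e / (`|x| + 1)) T -> ball (S x) e (T x).
Proof.
have x1 : 0 < `|x| + 1 by rewrite ltr_wpDl.
rewrite -!ball_normE /= ltr_pdivlMr// => ST.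
apply: le_lt_trans ST; apply: le_trans (le_opnorm (S - T) x) _.
by rewrite ler_wpM2l// lerDl.
Qed.

Lemma eval_continuous x : continuous (fun T : 'L(E, F) => T x).
Proof.
move=> T; apply/(cvg_ballP (FF := nbhs_filter T)) => e e0.
have d0 : 0 < e / (`|x| + 1) by rewrite divr_gt0 ?ltr_wpDl.
by apply: filterS (nbhsx_ballx T _ d0) => S; exact: eval_ball.
Qed.

End OperatorNorm.

(** * Completeness of the space of continuous operators *)

Section OperatorComplete.
Variables (R : realType) (E : normedModType R) (F : completeNormedModType R).

(** A Cauchy filter of operators is pointwise Cauchy, hence has a linear pointwise
    limit [g].  On a ball of radius [e] around [T] that belongs to the filter,
    passing to the limit gives [`|T x - g x| <= e * `|x|] ([g_near]); this bounds
    [g], and also turns pointwise convergence into convergence in norm. *)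
Lemma bounded_op_complete (G : set_system 'L(E, F)) :
  ProperFilter G -> cauchy G -> cvg G.
Proof.
move=> GG /cauchyP Gc.
have ptw x : cvg ((fun T : 'L(E, F) => T x) @ G).
  apply/cauchy_cvgP/cauchy_exP => e e0.
  have d0 : 0 < e / (`|x| + 1) by rewrite divr_gt0 ?ltr_wpDl.
  have [T GT] := Gc _ d0; exists (T x).
  change (G [set S : 'L(E, F) | ball (T x) e (S x)]).
  by apply: filterS GT => S /eval_ball.
pose g x := lim ((fun T : 'L(E, F) => T x) @ G).
have gP x : (fun T : 'L(E, F) => T x) @ G --> g x by exact: ptw.
have g_lin : linear g.
  move=> a x y; apply: cvg_lim => //.
  have -> : (fun T : 'L(E, F) => T (a *: x + y)) =
            (fun T : 'L(E, F) => a *: T x + T y).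
    by apply/funext => T; rewrite linearP.
  by apply: cvgD; [apply: cvgZl_tmp|]; exact: gP.
have g_near (e : R) T : G (ball T e) -> forall x, `|T x - g x| <= e * `|x|.
  move=> GT x.
  have cl := @closed_closed_ball_ R F (T x) (e * `|x|).
  apply: (@closed_cvg _ _ G _ (fun S : 'L(E, F) => S x) _ cl _ _ (gP x)).
  apply: filterS GT => S; rewrite -ball_normE /= => TS.
  rewrite /closed_ball_ /=; apply: le_trans (le_opnorm (T - S) x) _.
  by rewrite ler_wpM2r// ltW.
have g_cont : continuous g.
  pose gL := GRing.isLinear.Build R E F *:%R g g_lin.
  pose gl : {linear E -> F} := HB.pack g gL.
  apply: (@bounded_linear_continuous _ _ _ gl); apply/linear_boundedP.
  have [T /g_near gT] := Gc 1 ltr01.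
  near=> r => x; rewrite -(subKr (T x) (gl x)).
  apply: le_trans (ler_normB _ _) _.
  apply: le_trans (lerD (le_opnorm T x) (gT x)) _.
  rewrite -mulrDl ler_wpM2r//; near: r.
  by apply: nbhs_pinfty_ge; exact: num_real.
have g_in : g \in @continuous_linear R E F by apply/asboolP.
apply/cvg_ex; exists (BoundedOp g_in); apply/cvgrPdist_le => e e0.
have e20 : 0 < e / 2 by rewrite divr_gt0.
have [T GT] := Gc _ e20; apply: filterS (GT) => S.
rewrite -ball_normE /= => TS.
rewrite -(subrK T (BoundedOp g_in)) -addrA (splitr e).
apply: le_trans (ler_normD _ _) _; apply: lerD; last exact: ltW.
by apply: opnorm_le => [|x]; [exact: ltW|rewrite distrC; exact: g_near].
Unshelve. all: by end_near. Qed.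

HB.instance Definition _ :=
  Uniform_isComplete.Build 'L(E, F) bounded_op_complete.

End OperatorComplete.

(** * A sequential criterion for completeness *)

Section GeometricCauchy.
Variables (R : realType) (V : normedModType R).

(** Given a Cauchy filter [G], choose [u n] such that the ball of radius
    [2^-n / 2] around [u n] belongs to [G].  Two consecutive balls meet, so
    consecutive terms are less than [2^-n] apart, and [G] follows [u] to its
    limit. *)
Lemma geometric_complete :
  (forall u : V ^nat, (forall n, `|u n.+1 - u n| < 2^-1 ^+ n) -> cvgn u) ->
  forall G : set_system V, ProperFilter G -> cauchy G -> cvg G.
Proof.
move=> Vc G GG /cauchyP Gc.
have h0 n : 0 < 2^-1 ^+ n / 2 :> R by rewrite divr_gt0 ?exprn_gt0 ?invr_gt0.
pose u n := sval (cid (Gc _ (h0 n))).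
have uP n : G (ball (u n) (2^-1 ^+ n / 2)) by exact: svalP (cid (Gc _ (h0 n))).
have /cvg_ex[l ul] : cvgn u.
  apply: Vc => n; have [z] := filter_ex (filterI (uP n) (uP n.+1)).
  rewrite -!ball_normE /= distrC => -[unz uSz].
  rewrite -(subrK z (u n.+1)) -addrA; apply: le_lt_trans (ler_normD _ _) _.
  rewrite [ltRHS]splitr; apply: ltrD => //; apply: lt_le_trans uSz _.
  rewrite ler_wpM2r ?invr_ge0// exprS ler_piMl ?exprn_ge0 ?invr_ge0//.
  by rewrite invf_le1// ler1n.
apply/cvg_ex; exists l; apply/cvgrPdist_lt => e e0.
have e20 : 0 < e / 2 by rewrite divr_gt0.
near \oo => n.
apply: filterS (uP n) => x; rewrite -ball_normE /= => unx.
rewrite -(subrK (u n) l) -addrA (splitr e); apply: le_lt_trans (ler_normD _ _) _.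
apply: ltrD; first by near: n; exact: cvgr_dist_lt ul _ e20.
apply: lt_le_trans unx _; rewrite ler_wpM2r ?invr_ge0//.
suff : `|0 - 2^-1 ^+ n : R| <= e.
  by rewrite sub0r normrN ger0_norm ?exprn_ge0 ?invr_ge0.
near: n; apply: cvgr_dist_le => //.
by apply: cvg_expr; rewrite ger0_norm ?invr_ge0// invf_lt1// ltr1n.
Unshelve. all: by end_near. Qed.

End GeometricCauchy.

(** * Order and domination between operators *)

Section Domination.
Variables (R : realType) (E F : banachLatticeType R).
Implicit Types (S T : 'L(E, F)).

Lemma op_le_sub S T : op_le S T <-> op_le 0 (T - S).
Proof.
split=> h x x0; have := h x x0; first by rewrite vle_sub.
by rewrite [vle (S x) _]vle_sub.
Qed.

Lemma op_leD S T S' T' : op_le S T -> op_le S' T' -> op_le (S + S') (T + T').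
Proof. by move=> ST ST' x x0; apply: vleD; [exact: ST|exact: ST']. Qed.

Lemma op_ge0D S T : op_le 0 S -> op_le 0 T -> op_le 0 (S + T).
Proof. by move=> S0 T0; have := op_leD S0 T0; rewrite addr0. Qed.

Lemma op_leZ (a : R) S T : 0 <= a -> op_le S T -> op_le (a *: S) (a *: T).
Proof. by move=> a0 ST x x0; apply: vleZ => //; exact: ST. Qed.

Lemma op_ge0Z (a : R) S : 0 <= a -> op_le 0 S -> op_le 0 (a *: S).
Proof. by move=> a0 S0; have := op_leZ a0 S0; rewrite scaler0. Qed.

(** An intersection, over the positive [x], of preimages of the closed positive
    cone of [F] under the continuous maps [S |-> S x - T x]. *)
Lemma op_ge_closed T : closed [set S : 'L(E, F) | op_le T S].
Proof.
have -> : [set S : 'L(E, F) | op_le T S] =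
    \bigcap_(x in [set x : E | vle 0 x])
      [set S : 'L(E, F) | vle 0 (S x - T x)].
  apply/seteqP; split => S TS x x0; have := TS x x0;
  by rewrite /= [vle (T x) _]vle_sub.
apply: closed_bigI => x _.
apply: (preimage_closed _ (@vle0_closed R F)) => S _.
apply: (@cvgB _ _ _ (nbhs S)); last exact: cvg_cst.
exact: (@eval_continuous R E F x S).
Qed.

Lemma nondecreasing_op_lim (V : nat -> 'L(E, F)) (L : 'L(E, F)) :
  (forall n, op_le (V n) (V n.+1)) -> V @ \oo --> L -> forall n, op_le (V n) L.
Proof.
move=> V_nd VL n; apply: (closed_cvg _ (@op_ge_closed (V n)) _ _ VL).
exists n => // m /= /subnK <-; elim: (m - n)%N => [x _|k IH x x0].
  exact: vle_refl.
by apply: vle_trans (IH x x0) _; exact: V_nd.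
Qed.

(** The hypothesis says that [series S n - T n] is nondecreasing in [n]; each of its
    terms is then below its limit [A - L]. *)
Lemma op_le_series_tail (S T : nat -> 'L(E, F)) (A L : 'L(E, F)) :
  (forall n, op_le (T n.+1 - T n) (S n)) ->
  series S @ \oo --> A -> T @ \oo --> L ->
  forall n, op_le (L - T n) (A - series S n).
Proof.
move=> TS SA TL n; apply/op_le_sub; rewrite subrACA; apply: (op_le_sub _ _).1.
apply: (@nondecreasing_op_lim (fun n => series S n - T n)) => [m|].
  apply/op_le_sub; rewrite seriesSr subrACA [_ + S m]addrC addrK.
  exact: (op_le_sub _ _).1 (TS m).
exact: cvgB.
Qed.

Definition dominates T S := op_le T S /\ op_le (- T) S.

Lemma dominatesD T S T' S' :
  dominates T S -> dominates T' S' -> dominates (T + T') (S + S').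
Proof.
by move=> [TS nTS] [TS' nTS']; split; rewrite ?opprD; exact: op_leD.
Qed.

Lemma dominatesZ (a : R) T S : dominates T S -> dominates (a *: T) (`|a| *: S).
Proof.
move=> [TS nTS]; split.
  have [a0|a0] := leP 0 a; first by rewrite ger0_norm//; exact: op_leZ.
  rewrite ltr0_norm// -[a *: T]opprK -scalerN -scaleNr.
  by apply: op_leZ => //; rewrite oppr_ge0 ltW.
have [a0|a0] := leP 0 a.
  by rewrite ger0_norm// -scalerN; exact: op_leZ.
by rewrite ltr0_norm// -scaleNr; apply: op_leZ => //; rewrite oppr_ge0 ltW.
Qed.

(** Let [p] and [q] be the positive and negative parts of [x].  Then
    [T x = T p - T q <= S p + S q = S (vabs x)], and likewise for [- T x], so
    [`|T x| <= `|S (vabs x)| <= `|S| * `|x|]. *)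
Lemma dominates_opnorm T S : dominates T S -> `|T| <= `|S|.
Proof.
move=> [TS nTS]; apply: opnorm_le => // x.
have TSx U : op_le U S -> op_le (- U) S -> vle (U x) (S (vabs x)).
  move=> US nUS; set p := 2^-1 *: (vabs x + x); set q := 2^-1 *: (vabs x - x).
  have p0 : vle 0 p.
    apply: vscale_ge0; first by rewrite invr_ge0.
    by have := leN_vabs x; rewrite vle_sub opprK.
  have q0 : vle 0 q.
    apply: vscale_ge0; first by rewrite invr_ge0.
    by have := le_vabs x; rewrite vle_sub.
  have pBq : p - q = x.
    by rewrite -scalerBr opprB [_ + x + _]addrC addrA subrK half_double.
  have pDq : p + q = vabs x.
    by rewrite -scalerDr addrACA subrr addr0 half_double.
  rewrite -pDq -[X in U X]pBq linearB linearD.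
  by apply: vleD; [exact: US|exact: nUS].
rewrite -[X in _ * X]norm_vabs; apply: le_trans (le_opnorm S (vabs x)).
apply: vle_pm_norm; first exact: TSx.
by have := TSx (- T); apply => //; rewrite opprK.
Qed.

Lemma dominates_series_tail (S T : nat -> 'L(E, F)) (A L : 'L(E, F)) :
  (forall n, dominates (T n.+1 - T n) (S n)) ->
  series S @ \oo --> A -> T @ \oo --> L ->
  forall n, dominates (L - T n) (A - series S n).
Proof.
move=> TS SA TL n; split.
  by apply: (op_le_series_tail _ SA TL) => m; have [] := TS m.
rewrite opprD; apply: (@op_le_series_tail S (fun n => - T n)) => // [m|].
  by rewrite -opprD; have [] := TS m.
exact: cvgN.
Qed.

End Domination.

(** * The enveloping norm *)

(** Bundling the subspace with its closure properties lets the algebraic and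
    topological structures on the type of regular operators be canonical: that
    type then determines the proofs on which these structures depend. *)
Record closedSubspace (R : realType) (V : normedModType R) := ClosedSubspace {
  subspace_set : set V;
  subspace_submod : submod_closed [in subspace_set];
  subspace_closed : closed subspace_set
}.

Section EnvelopingNorm.
Variables (R : realType) (E F : banachLatticeType R).
Variable Q : closedSubspace 'L(E, F).
Local Notation P := (subspace_set Q).
Implicit Types (S T : 'L(E, F)).

Let P0 : P 0.
Proof. by have [/set_mem] := subspace_submod Q. Qed.

Let PD S T : P S -> P T -> P (S + T).
Proof.
move=> PS PT; have [_ /(_ 1 S T)] := subspace_submod Q.
by rewrite scale1r => h; apply/set_mem/h; exact/mem_set.
Qed.

Let PZ (a : R) S : P S -> P (a *: S).
Proof.
move=> PS; have [_ /(_ a S 0)] := subspace_submod Q.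
by rewrite addr0 => h; apply/set_mem/h; exact/mem_set.
Qed.

Let PN S : P S -> P (- S).
Proof. by rewrite -scaleN1r; exact: PZ. Qed.

Let subspace_lim (V : nat -> 'L(E, F)) (L : 'L(E, F)) :
  (forall n, P (V n)) -> V @ \oo --> L -> P L.
Proof.
move=> PV VL; apply: (closed_cvg _ (@subspace_closed _ _ Q) _ _ VL).
exact: nearW.
Qed.

(** If [T = T1 - T2] then [T1 + T2] dominates [T]; conversely, if [S] dominates [T]
    then [(S + T) / 2] and [(S - T) / 2] are positive with difference [T]. *)
Lemma regularlyP T :
  regularly P T <-> P T /\ exists2 S, P S & dominates T S.
Proof.
split=> [[T1 [T2 [[PT1 T10] [PT2 T20] ->]]]|[PT [S PS [TS nTS]]]].
  split; first by apply: PD => //; exact: PN.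
  exists (T1 + T2); first exact: PD.
  split; apply/op_le_sub.
    by rewrite opprD opprK addrACA subrr add0r; exact: op_ge0D.
  by rewrite opprK addrACA subrr addr0; exact: op_ge0D.
exists (2^-1 *: (S + T)), (2^-1 *: (S - T)); split.
- split; first by apply/PZ/PD.
  apply: op_ge0Z; first by rewrite invr_ge0.
  by have /op_le_sub := nTS; rewrite opprK.
- split; first by apply/PZ/PD => //; exact: PN.
  apply: op_ge0Z; first by rewrite invr_ge0.
  by have /op_le_sub := TS.
- transitivity (2^-1 *: (S + T - (S - T))); last exact: scalerBr.
  by rewrite opprB [S + T + _]addrC addrA subrK half_double.
Qed.

Definition regular_pred : {pred 'L(E, F)} := fun T => `[< regularly P T >].

Lemma regular_submod_closed : submod_closed regular_pred.
Proof.
split.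
  apply/asboolP/regularlyP; split=> //; exists 0 => //.
  by split; rewrite ?oppr0 => x _; exact: vle_refl.
move=> a S T /asboolP/regularlyP[PS [S' PS' SS']].
move=> /asboolP/regularlyP[PT [T' PT' TT']]; apply/asboolP/regularlyP; split.
  by apply: PD => //; exact: PZ.
exists (`|a| *: S' + T'); first by apply: PD => //; exact: PZ.
by apply: dominatesD => //; exact: dominatesZ.
Qed.

HB.instance Definition _ :=
  GRing.isSubmodClosed.Build R 'L(E, F) regular_pred regular_submod_closed.

Record regular_op := RegularOp {
  regular_op_val :> 'L(E, F);
  regular_opP : regular_op_val \in regular_pred
}.

HB.instance Definition _ := [isSub for regular_op_val].
HB.instance Definition _ := [Choice of regular_op by <:].
HB.instance Definition _ := [SubChoice_isSubLmodule of regular_op by <:].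

Implicit Types U : regular_op.

Definition renorm U : R := enveloping_norm P U.

Lemma regular_op_dominated U : exists2 S, P S & dominates U S.
Proof. by have /asboolP/regularlyP[] := regular_opP U. Qed.

Lemma renorm_le U S : P S -> dominates U S -> renorm U <= `|S|.
Proof.
move=> PS [US nUS]; apply: ge_inf; last by exists S.
by exists 0 => _ [S' _ <-].
Qed.

Lemma le_renorm U (c : R) :
  (forall S, P S -> dominates U S -> c <= `|S|) -> c <= renorm U.
Proof.
move=> h; apply: lb_le_inf.
  by have [S PS [US nUS]] := regular_op_dominated U; exists `|S|, S.
by move=> _ [S [PS US nUS] <-]; exact: h.
Qed.

Lemma renorm_lt U (c : R) :
  renorm U < c -> exists S, [/\ P S, dominates U S & `|S| < c].
Proof.
move=> Uc; apply: contrapT => h; suff : c <= renorm U by rewrite leNgt Uc.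
apply: le_renorm => S PS US; rewrite leNgt; apply/negP => Sc.
by apply: h; exists S.
Qed.

Lemma renormD U U' : renorm (U + U') <= renorm U + renorm U'.
Proof.
rewrite -lerBlDr; apply: le_renorm => S PS US.
rewrite lerBlDr -lerBlDl; apply: le_renorm => S' PS' US'.
rewrite lerBlDl; apply: le_trans (ler_normD S S').
by apply: renorm_le; [exact: PD|exact: dominatesD].
Qed.

Lemma renorm_ge0 U : 0 <= renorm U.
Proof. exact: le_renorm. Qed.

Lemma renormZ_le (a : R) U : renorm (a *: U) <= `|a| * renorm U.
Proof.
have [->|a0] := eqVneq a 0.
  rewrite scale0r normr0 mul0r -[X in _ <= X](@normr0 R 'L(E, F)).
  apply: renorm_le => //; split; rewrite ?oppr0 => x _; exact: vle_refl.
rewrite -ler_pdivrMl ?normr_gt0//; apply: le_renorm => S PS US.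
rewrite ler_pdivrMl ?normr_gt0// -[`|a|]normr_id -normrZ.
by apply: renorm_le; [exact: PZ|exact: dominatesZ].
Qed.

(** The reverse inequality is [renormZ_le] for the inverse scalar. *)
Lemma renormZ (a : R) U : renorm (a *: U) = `|a| * renorm U.
Proof.
apply/eqP; rewrite eq_le renormZ_le /=.
have [->|a0] := eqVneq a 0; first by rewrite normr0 mul0r renorm_ge0.
rewrite -ler_pdivlMl ?normr_gt0// -normfV.
by rewrite -{1}(scalerK a0 U); exact: renormZ_le.
Qed.

Lemma opnorm_le_renorm U : `|U : 'L(E, F)| <= renorm U.
Proof. by apply: le_renorm => S _; exact: dominates_opnorm. Qed.

Lemma renorm_eq0 U : renorm U = 0 -> U = 0.
Proof.
move=> U0; apply/val_inj/eqP; rewrite -normr_le0 -U0; exact: opnorm_le_renorm.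
Qed.

HB.instance Definition _ :=
  Lmodule_isNormed.Build R regular_op renormD renormZ renorm_eq0.

(** Both the dominating series and the sequence converge in operator norm; the
    tails of the series dominate the distance of the sequence to its limit, and
    so control it in the enveloping norm. *)
Lemma renorm_geometric_cvg (u : regular_op ^nat) :
  (forall n, `|u n.+1 - u n| < 2^-1 ^+ n) -> cvgn u.
Proof.
move=> u_geo.
have /choice[S SP] n :
    exists S, [/\ P S, dominates (u n.+1 - u n) S & `|S| < 2^-1 ^+ n].
  by have := @renorm_lt (u n.+1 - u n) _ (u_geo n).
have geo_cvg : cvgn (series (geometric 1 2^-1 : R^nat)).
  apply: is_cvg_geometric_series.
  by rewrite ger0_norm ?invr_ge0// invf_lt1// ltr1n.
have cvg_geo (V : 'L(E, F) ^nat) :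
    (forall n, `|V n| <= 2^-1 ^+ n) -> cvgn (series V).
  move=> VS; apply: normed_cvg; apply: series_le_cvg geo_cvg => n /=.
  - exact: normr_ge0.
  - by rewrite mul1r exprn_ge0 ?invr_ge0.
  - by rewrite mul1r.
have /cvg_ex[A SA] : cvgn (series S).
  by apply: cvg_geo => n; have [_ _ /ltW] := SP n.
pose T n : 'L(E, F) := u n.
have /cvg_ex[L TL] : cvgn T.
  have /cvg_ex[L' TL'] : cvgn (series (telescope T)).
    apply: cvg_geo => n; have [_ US /ltW] := SP n; apply: le_trans.
    exact: dominates_opnorm US.
  apply/cvg_ex; exists (L' + T 0%N).
  have TE n : series (telescope T) n + T 0%N = T n by rewrite telescopeK subrK.
  have : (fun n => series (telescope T) n + T 0%N) @ \oo --> L' + T 0%N.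
    exact: cvgD TL' (cvg_cst _).
  by rewrite (funext TE).
have PA n : P (series S n).
  elim: n => [|n IH]; first by rewrite /series /= big_geq.
  by rewrite seriesSr; apply: PD => //; have [] := SP n.
have PSA : P A := subspace_lim PA SA.
have PT n : P (T n) by have /asboolP/regularlyP[] := regular_opP (u n).
have PL : P L := subspace_lim PT TL.
have dom n : dominates (L - T n) (A - series S n).
  by apply: dominates_series_tail SA TL n => n; have [] := SP n.
(* [L] is [L - T 0], dominated by the whole series, plus the regular [T 0]. *)
have Lreg : L \in regular_pred.
  apply/asboolP/regularlyP; split=> //.
  have [S0 PS0 TS0] := regular_op_dominated (u 0%N).
  exists (A - series S 0%N + S0).
    by apply: PD => //; apply: PD => //; exact: PN.
  by rewrite -(subrK (T 0%N) L); exact: dominatesD.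
apply/cvg_ex; exists (RegularOp Lreg); apply/cvgrPdist_le => e e0.
have /cvgrPdist_le/(_ e e0) := SA; apply: filterS => n; apply: le_trans.
apply: renorm_le; last exact: dom.
by apply: PD => //; exact: PN.
Qed.

HB.instance Definition _ := Uniform_isComplete.Build regular_op
  (geometric_complete renorm_geometric_cvg).

End EnvelopingNorm.

Theorem theorem6 (R : realType) (E F : banachLatticeType R)
    (P : set 'L(E, F)) (P_subspace : submod_closed [in P]) (P_closed : closed P) :
  is_banach (regularly P) (enveloping_norm P).
Proof.
pose Q := ClosedSubspace P_subspace P_closed.
exists (regular_op Q), (\val : {linear regular_op Q -> 'L(E, F)}); split => //.
apply/seteqP; split => [_ [U _ <-]|T TP].
  by have /asboolP := regular_opP U.
have TQ : T \in regular_pred Q by exact/asboolP.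
by exists (RegularOp TQ).
Qed.
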